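(* Let $G$ be a $\mathscr C_1^{(4)}$-hom-free $4$-graph on $n\ge1$ vertices. Then $e(G)<n^4/48$.
   Context: A $4$-graph is a $4$-uniform hypergraph; $e(G)$ is its number of edges. For $\ell>4$, the tight cycle $C_\ell^{(4)}$ has vertices $v_1,\dots,v_\ell$ and edges $\{v_i,v_{i+1},v_{i+2},v_{i+3}\}$, $1\le i\le\ell$ (indices mod $\ell$). A homomorphism $F\to G$ is a map $V(F)\to V(G)$ sending each edge of $F$ onto an edge of $G$. $G$ is $\mathscr C_1^{(4)}$-hom-free if there is no homomorphism $C_\ell^{(4)}\to G$ for any $\ell>4$ with $\ell\equiv1\pmod4$. *)

(* Defs.v *)
From mathcomp Require Import all_boot.
Set Implicit Arguments. Unset Strict Implicit. Unset Printing Implicit Defensive.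

Definition four_graph (T : finType) (E : {set {set T}}) : Prop :=
  forall e, e \in E -> #|e| = 4.

Definition tight_cycle_edge (l : nat) (i : 'I_l) : {set 'I_l} :=
  [set j : 'I_l | [exists k : 'I_4, (val j == (val i + val k) %% l)]].

Definition tight_cycle_hom (T : finType) (E : {set {set T}}) (l : nat)
    (f : 'I_l -> T) : Prop :=
  forall i : 'I_l, f @: tight_cycle_edge i \in E.

Definition C1_hom_free (T : finType) (E : {set {set T}}) : Prop :=
  forall l : nat, 4 < l -> l %% 4 = 1 ->
    forall f : 'I_l -> T, ~ tight_cycle_hom E f.

(* Main.v *)
Require Import Defs.
From mathcomp Require Import all_boot.
From mathcomp Require Import zify.

(** The proof is a flag-algebra certificate on six points.  Write D(a,b) for the number of ordered
    pairs (c,d) with abcd an edge.  It suffices that sum D^2 <= n^2 (sum D) / 2: as D(a,a) = 0,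
    Cauchy-Schwarz over the n(n-1) off-diagonal pairs then gives 48 e <= n^3 (n-1).
    Both sides are sums over maps from six points to the vertices, and pulling G back along such
    a map leaves a hom-free 4-graph on six points.  Pointwise the inequality holds up to two sums
    of squares.  The first, over non-edges abcd, is (3u - v)^2, where u (resp. v) counts the w
    extending the triple abc (resp. all triples but abc) to an edge.  The second, over certain
    edges abcd, is (x - y)^2, where x (resp. y) counts the w extending exactly the two triples
    containing ab (resp. cd).  The six-point 4-graphs that are not hom-free are exactly those
    containing one of five closed walks of length 5, 9 or 13, and the inequality is checked on all
    the others by exhaustive search. *)
Set Implicit Arguments. Unset Strict Implicit. Unset Printing Implicit Defensive.

(** * Closed walks as images of tight cycles *)

Definition windows (A : Type) (w : seq A) : seq (seq A) :=
  [seq take 4 (rot i w) | i <- iota 0 (size w)].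

Lemma windows_map (A B : Type) (f : A -> B) (w : seq A) :
  windows (map f w) = map (map f) (windows w).
Proof.
rewrite /windows size_map -map_comp; apply: eq_map => i /=.
by rewrite -map_rot map_take.
Qed.

Lemma nth_rot_mod (A : Type) (x0 : A) (w : seq A) (i k : nat) :
  i < size w -> k < size w -> nth x0 (rot i w) k = nth x0 w ((i + k) %% size w).
Proof.
move=> iw kw; rewrite nth_cat size_drop nth_drop.
case: ltnP => h; first by rewrite modn_small //; lia.
rewrite nth_take; last by lia.
have -> : i + k = k - (size w - i) + size w by lia.
by rewrite modnDr modn_small //; lia.
Qed.

Definition edge_on (T : finType) (E : {set {set T}}) (s : seq T) : bool :=
  [set:: s] \in E.

Lemma edge_on_perm (T : finType) (E : {set {set T}}) (s t : seq T) :
  perm_eq s t -> edge_on E s = edge_on E t.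
Proof.
by move=> /perm_mem st; congr (_ \in E); apply/setP => x; rewrite !inE st.
Qed.

(** Reading [w] cyclically maps the tight cycle of length [size w] to [T], and the images of its
    edges are the windows of [w]. *)
Lemma closed_walk (T : finType) (E : {set {set T}}) (w : seq T) :
  C1_hom_free E -> 4 < size w -> size w %% 4 = 1 ->
  ~~ all (edge_on E) (windows w).
Proof.
move=> free w4 w1; apply/negP => /allP wE.
apply: (free (size w) w4 w1 (tnth (in_tuple w))) => i.
have -> : tnth (in_tuple w) @: tight_cycle_edge i = [set:: take 4 (rot i w)].
  have [x0 _] : exists x0 : T, true by exists (tnth (in_tuple w) i).
  apply/setP => y; rewrite inE; apply/imsetP/idP => [[j]|].
    rewrite inE => /existsP [[k k4] /eqP jk] ->.
    rewrite (tnth_nth x0) /= jk -nth_rot_mod ?ltn_ord ?(ltn_trans k4) //.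
    rewrite -(nth_take x0 k4); apply: mem_nth.
    by rewrite size_takel // size_rot ltnW.
  move=> /(nthP x0) [k]; rewrite size_takel ?size_rot ?(ltnW w4) // => k4.
  rewrite nth_take // nth_rot_mod ?ltn_ord ?(ltn_trans k4 w4) // => <-.
  have lt : (i + k) %% size w < size w by rewrite ltn_mod; apply: leq_ltn_trans w4.
  exists (Ordinal lt); last by rewrite (tnth_nth x0).
  by rewrite inE; apply/existsP; exists (Ordinal k4).
by apply: (wE (take 4 (rot i w))); apply: (map_f (fun i => take 4 (rot i w))); rewrite mem_iota /=.
Qed.

(** * Six-point placements and their relabellings *)

Definition quads : seq (seq nat) :=
  [seq s <- allpairs cat (allpairs (fun a b => [:: a; b]) (iota 0 6) (iota 0 6))
                         (allpairs (fun a b => [:: a; b]) (iota 0 6) (iota 0 6))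
   | sorted ltn s].

Definition quad_index (q : seq nat) : nat := index (sort leq q) quads.

Definition orders : seq (seq nat) := permutations (iota 0 6).

Definition relabel (s q : seq nat) : seq nat := [seq nth 0 s i | i <- q].

(** Nested so that [pair_bigA] splits a sum over six points into one over a quad and one over the
    remaining pair. *)
Definition six (T : Type) : Type := (((T * T) * (T * T)) * (T * T))%type.

Definition vertex (T : Type) (x : six T) (i : nat) : T :=
  nth x.2.2 [:: x.1.1.1; x.1.1.2; x.1.2.1; x.1.2.2; x.2.1] i.

Definition act (T : Type) (s : seq nat) (x : six T) : six T :=
  let v i := vertex x (nth 0 s i) in (((v 0, v 1), (v 2, v 3)), (v 4, v 5)).

Lemma vertex_act (T : Type) (s : seq nat) (x : six T) (i : nat) :
  i < 6 -> vertex (act s x) i = vertex x (nth 0 s i).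
Proof. by do 6?[case: i => [//|i]]. Qed.

Lemma act_inj (T : Type) (s : seq nat) : s \in orders -> injective (@act T s).
Proof.
rewrite mem_permutations => ps x y axy.
have eqv i : i < 6 -> vertex x i = vertex y i.
  move=> i6; have : i \in s by rewrite (perm_mem ps) mem_iota.
  move=> /(nthP 0) [j]; rewrite (perm_size ps) size_iota => j6 <-.
  by rewrite -!vertex_act // axy.
case: x y eqv {axy} => [[[a b] [c d]] [e f]] [[[a' b'] [c' d']] [e' f']] eqv.
have := (eqv 0 isT, eqv 1 isT, eqv 2 isT, eqv 3 isT, eqv 4 isT, eqv 5 isT).
by rewrite /vertex /=; move=> [[[[[-> ->] ->] ->] ->] ->].
Qed.

Lemma sum_act (T : finType) (s : seq nat) (F : six T -> nat) :
  s \in orders -> \sum_x F (act s x) = \sum_x F x.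
Proof. by move=> os; rewrite [RHS](reindex_inj (act_inj os)). Qed.

(** * Patterns compiled to bit positions *)

Definition pattern : Type := seq (seq nat * bool).

(* Nested conditionals instead of [all], whose conjunctions [vm_compute] would evaluate eagerly. *)
Fixpoint sat (I : Type) (J : I -> bool) (p : seq (I * bool)) : bool :=
  if p is (q, b) :: p' then (if addb (J q) b then false else sat J p') else true.

Lemma sat_cat (I : Type) (J : I -> bool) (p r : seq (I * bool)) :
  sat J (p ++ r) = sat J p && sat J r.
Proof. by elim: p => //= -[q b] p ->; case: ifP. Qed.

Lemma eq_sat_map (I I' : eqType) (J : I -> bool) (J' : I' -> bool) (h : I -> I')
    (p : seq (I * bool)) :
  (forall l, l \in p -> J' (h l.1) = J l.1) ->
  sat J' [seq (h l.1, l.2) | l <- p] = sat J p.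
Proof.
elim: p => //= -[q b] p IH H /=.
rewrite (H (q, b)) ?inE ?eqxx // IH // => l lp.
by apply: H; rewrite inE lp orbT.
Qed.

Definition compile (s : seq nat) (p : pattern) : seq (nat * bool) :=
  [seq (quad_index (relabel s l.1), l.2) | l <- p].

Definition profile (o : seq (seq nat)) (p : pattern) : seq (seq (nat * bool)) :=
  [seq compile s p | s <- o].

Section Placement.
Variables (T : finType) (E : {set {set T}}).

Definition edge_at (x : six T) (q : seq nat) : bool := edge_on E (map (vertex x) q).

Definition bits (x : six T) : seq bool := [seq edge_at x q | q <- quads].

Lemma bits_valid (x : six T) (q : seq nat) :
  sort leq q \in quads -> nth false (bits x) (quad_index q) = edge_at x q.
Proof.
move=> qq; rewrite (nth_map [::]) ?index_mem // nth_index //.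
by apply: edge_on_perm; apply: perm_map; rewrite perm_sort.
Qed.

(** A list that is not a genuine quad gets an out-of-range index, which reads the default
    [false]. *)
Lemma bits_edge (x : six T) (q : seq nat) :
  nth false (bits x) (quad_index q) -> edge_at x q.
Proof.
move=> h; rewrite -bits_valid // -index_mem.
rewrite leqNgt ltnS; apply: contraL h => h.
by rewrite nth_default // size_map.
Qed.

Definition well_placed (p : pattern) : bool :=
  all (fun l => all (fun i => i < 6) l.1 &&
                all (fun s => sort leq (relabel s l.1) \in quads) orders) p.

Lemma sat_compile (x : six T) (s : seq nat) (p : pattern) :
  s \in orders -> well_placed p ->
  sat (nth false (bits x)) (compile s p) = sat (edge_at (act s x)) p.
Proof.
move=> os /allP wp; apply: (eq_sat_map (h := fun q => quad_index (relabel s q))) => l lp.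
have /andP [/allP l6 /allP lo] := wp _ lp.
rewrite bits_valid ?lo // /edge_at /relabel -map_comp; congr edge_on.
by apply/eq_in_map => i il /=; rewrite vertex_act // l6.
Qed.

(** A relabelling permutes the maps from six points to [T], so every order contributes the same
    total. *)
Lemma sum_profile (o : seq (seq nat)) (p : pattern) :
  {subset o <= orders} -> well_placed p ->
  \sum_x count (sat (nth false (bits x))) (profile o p)
  = size o * \sum_x sat (edge_at x) p.
Proof.
move=> oo wp.
transitivity (\sum_x \sum_(s <- o) (sat (edge_at (act s x)) p : nat)).
  apply: eq_bigr => x _; rewrite count_map -sum1_count big_mkcond.
  by apply: eq_big_seq => s so /=; rewrite sat_compile ?oo //; case: sat.
rewrite exchange_big /= (eq_big_seq (fun=> \sum_x (sat (edge_at x) p : nat))); last first.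
  by move=> s so; rewrite (sum_act (fun x => sat (edge_at x) p : nat)) ?oo.
by rewrite big_const_seq count_predT iter_addn_0 mulnC.
Qed.

End Placement.

(** * The terms of the certificate *)

Definition base_quad : seq nat := [:: 0; 1; 2; 3].

(* The literals prescribing which of the triples 012, 013, 023, 123 form an edge with [w]. *)
Definition ext (w : nat) (b0 b1 b2 b3 : bool) : pattern :=
  [:: ([:: 0; 1; 2; w], b0); ([:: 0; 1; 3; w], b1);
      ([:: 0; 2; 3; w], b2); ([:: 1; 2; 3; w], b3)].

Definition edge_pat : pattern := [:: (base_quad, true)].
Definition cherry_pat : pattern := [:: (base_quad, true); ([:: 0; 1; 4; 5], true)].
Definition split_pat : pattern :=
  (base_quad, true) :: ext 4 true true false false ++ ext 5 false false true true.
Definition same_pat : pattern :=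
  (base_quad, true) :: ext 4 true true false false ++ ext 5 true true false false.
(* Forced by [same_pat] when 0123 is [crossed] below, and needed for [local_ineq] to hold. *)
Definition cross_pat : pattern :=
  [:: ([:: 0; 2; 4; 5], false); ([:: 0; 3; 4; 5], false);
      ([:: 1; 2; 4; 5], false); ([:: 1; 3; 4; 5], false)].
(* In the next three names, [one] is a vertex extending only 012, [co] one extending all but 012. *)
Definition one_one_pat : pattern :=
  (base_quad, false) :: ext 4 true false false false ++ ext 5 true false false false.
Definition co_co_pat : pattern :=
  (base_quad, false) :: ext 4 false true true true ++ ext 5 false true true true.
Definition one_co_pat : pattern :=
  (base_quad, false) :: ext 4 true false false false ++ ext 5 false true true true.

(* One representative of each symmetry class of [edge_pat], [cherry_pat], [same_pat] and [split_pat],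
   [one_one_pat] and its variants, respectively. *)
Definition orders15 : seq (seq nat) :=
  [seq s <- orders | sorted ltn (take 4 s) && sorted ltn (drop 4 s)].
Definition orders45 : seq (seq nat) :=
  [seq s <- orders | [&& nth 0 s 0 < nth 0 s 1, nth 0 s 2 < nth 0 s 3,
                         nth 0 s 4 < nth 0 s 5 & nth 0 s 2 < nth 0 s 4]].
Definition orders90 : seq (seq nat) :=
  [seq s <- orders | [&& nth 0 s 0 < nth 0 s 1, nth 0 s 2 < nth 0 s 3 & nth 0 s 4 < nth 0 s 5]].
Definition orders120 : seq (seq nat) := [seq s <- orders | sorted ltn (take 3 s)].

(* The [let]s stand outside the abstraction so that [vm_compute] compiles each profile only once. *)
Definition local_ineq : seq bool -> bool :=
  let edge := profile orders15 edge_pat in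
  let cherry := profile orders45 cherry_pat in
  let split := profile orders90 split_pat in
  let same := profile orders90 (same_pat ++ cross_pat) in
  let one_one := profile orders120 one_one_pat in
  let co_co := profile orders120 co_co_pat in
  let one_co := profile orders120 one_co_pat in
  fun G => let N := count (sat (nth false G)) in
  18 * N cherry + 12 * N same + 9 * N one_one + N co_co
  <= 27 * N edge + 12 * N split + 6 * N one_co.

(** * Exhaustive search over six-point 4-graphs *)

Definition odd_walks : seq (seq nat) :=
  [:: [:: 0; 1; 2; 3; 4];
      [:: 0; 1; 2; 5; 0; 1; 3; 2; 4];
      [:: 0; 1; 5; 2; 0; 3; 1; 2; 4];
      [:: 0; 1; 2; 5; 0; 3; 1; 4; 2; 0; 1; 4; 5];
      [:: 0; 1; 3; 4; 2; 0; 3; 5; 2; 0; 1; 5; 4]].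

(** Sorted and free of repetitions because the search decides bits in increasing order and
    [restrict] inspects only heads. *)
Definition walk_support (w : seq nat) : seq nat :=
  sort leq (undup (map quad_index (windows w))).

Definition obstructions : seq (seq nat) :=
  allpairs (fun w s => walk_support (relabel s w)) odd_walks orders.

(** Members of [F] hold the bits that obstructions still require; an empty one signals an
    obstruction fully present. *)
Definition restrict (k : nat) (b : bool) (F : seq (seq nat)) : seq (seq nat) :=
  if b then [seq if s is i :: s' then if i == k then s' else s else s | s <- F]
  else [seq s <- F | ohead s != Some k].

(* Runs through the bit strings that contain no member of [F], deciding bit [k] at depth [k]. *)
Fixpoint search (P : seq bool -> bool) (n k : nat) (acc : seq bool) (F : seq (seq nat)) : bool :=
  if has (fun s => s == [::]) F then true else
  if n is n'.+1 then
    if search P n' k.+1 (true :: acc) (restrict k true F) then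
      search P n' k.+1 (false :: acc) (restrict k false F)
    else false
  else P (rev acc).

Lemma searchP (P : seq bool -> bool) (n : nat) (acc : seq bool) (F : seq (seq nat)) (G : seq bool) :
  search P n (size acc) acc F -> size G = n ->
  has (all (nth false (rev acc ++ G))) F \/ P (rev acc ++ G).
Proof.
elim: n acc F G => [|n IH] acc F G /=.
  case: hasP => [[s sF /eqP s0] _ _|_ PG /size0nil ->]; last by right; rewrite cats0.
  by left; apply/hasP; exists s; rewrite // s0.
case: hasP => [[s sF /eqP s0] _ _|_].
  by left; apply/hasP; exists s; rewrite // s0.
case: ifP => // St Sf; case: G => // b G [sG].
have eqG : rev acc ++ b :: G = rev (b :: acc) ++ G by rewrite rev_cons cat_rcons.
have bk : nth false (rev acc ++ b :: G) (size acc) = b.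
  by rewrite nth_cat size_rev ltnn subnn.
have [|hF|PG] := IH (b :: acc) (restrict (size acc) b F) G _ sG; first by case: b {eqG bk}.
  (* An obstruction met after [restrict] was met before it: the only index stripped is that of the
     bit just set to true. *)
  left; rewrite -eqG in hF; case: b bk hF {eqG} => /= bk; last first.
    by case/hasP => s; rewrite mem_filter => /andP [_ sF] sG'; apply/hasP; exists s.
  case/hasP => _ /mapP [s sF ->] sG'; apply/hasP; exists s => //.
  by case: s sG' {sF} => //= i s; case: eqP => //= -> ->; rewrite bk.
by right; rewrite eqG.
Qed.


Lemma search_sound (P : seq bool -> bool) (F : seq (seq nat)) (G : seq bool) (n : nat) :
  search P n 0 [::] F -> size G = n -> ~~ has (all (nth false G)) F -> P G.
Proof. by move=> ok sG /negbTE noF; case: (@searchP P n [::] F G ok sG) => //=; rewrite noF. Qed.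

Lemma obstructionsP (T : finType) (E : {set {set T}}) (x : six T) :
  C1_hom_free E -> ~~ has (all (nth false (bits E x))) obstructions.
Proof.
move=> free; apply/negP.
move=> /hasP [sup /allpairsP [[w s] /= [wW so ->]]] /allP wG.
have : ~~ all (edge_on E) (windows (map (vertex x) (relabel s w))).
  have /allP/(_ w wW)/andP [w4 /eqP w1] :
    all (fun u => (4 < size u) && (size u %% 4 == 1)) odd_walks by [].
  by apply: closed_walk => //; rewrite !size_map.
case/negP; rewrite windows_map all_map; apply/allP => q qw /=.
apply: bits_edge; apply: wG; rewrite mem_sort mem_undup; exact: map_f.
Qed.


Lemma search_bits (T : finType) (E : {set {set T}}) (x : six T) (P : seq bool -> bool) :
  C1_hom_free E -> search P 15 0 [::] obstructions -> P (bits E x).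
Proof.
move=> free ok; apply: (search_sound ok); last exact: obstructionsP.
by rewrite size_map.
Qed.

Lemma search_ok : search local_ineq 15 0 [::] obstructions.
Proof. by vm_compute. Qed.

Lemma local_ineq_holds (T : finType) (E : {set {set T}}) (x : six T) :
  C1_hom_free E -> local_ineq (bits E x).
Proof. by move=> free; apply: search_bits free search_ok. Qed.

(** * Averaging the local inequality *)

Definition frequency (T : finType) (E : {set {set T}}) (p : pattern) : nat :=
  \sum_x (sat (edge_at E x) p : nat).

(** With the numbers of orders multiplied in, the weights are 810 for cherries against 405 for
    edges, 1080 for [same_pat] against [split_pat], and 120 times those of [9u^2 - 6uv + v^2]. *)
Lemma sum_local_ineq (T : finType) (E : {set {set T}}) :
  C1_hom_free E ->
  18 * (45 * frequency E cherry_pat) + 12 * (90 * frequency E (same_pat ++ cross_pat))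
    + 9 * (120 * frequency E one_one_pat) + 120 * frequency E co_co_pat
  <= 27 * (15 * frequency E edge_pat) + 12 * (90 * frequency E split_pat)
    + 6 * (120 * frequency E one_co_pat).
Proof.
move=> free.
have sub P : {subset [seq s <- orders | P s] <= orders} by move=> s; rewrite mem_filter => /andP [].
have freq (P : pred (seq nat)) n p : size [seq s <- orders | P s] = n -> well_placed p ->
    n * frequency E p = \sum_x count (sat (nth false (bits E x))) (profile [seq s <- orders | P s] p).
  by move=> <- wp; rewrite sum_profile //; exact: sub.
rewrite (freq _ 15 edge_pat (erefl : size orders15 = 15)); last by vm_compute.
rewrite (freq _ 45 cherry_pat (erefl : size orders45 = 45)); last by vm_compute.
rewrite (freq _ 90 split_pat (erefl : size orders90 = 90)); last by vm_compute.
rewrite (freq _ 90 (same_pat ++ cross_pat) (erefl : size orders90 = 90)); last by vm_compute.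
rewrite (freq _ 120 one_one_pat (erefl : size orders120 = 120)); last by vm_compute.
rewrite (freq _ 120 co_co_pat (erefl : size orders120 = 120)); last by vm_compute.
rewrite (freq _ 120 one_co_pat (erefl : size orders120 = 120)); last by vm_compute.
rewrite !big_distrr -!big_split.
apply: leq_sum => x _; have := local_ineq_holds x free.
rewrite /local_ineq; cbv zeta.
exact.
Qed.

(** * Non-edges forced by closed walks on seven points *)

Lemma odd_walk_free (T : finType) (E : {set {set T}}) (f : nat -> T) (w : seq nat)
    (L : seq (seq nat)) :
  C1_hom_free E -> 4 < size w -> size w %% 4 = 1 ->
  all (fun q => sort leq q \in L) (windows w) -> ~~ all (fun q => edge_on E (map f q)) L.
Proof.
move=> free w4 w1 /allP wL.
have := closed_walk (w := map f w) free; rewrite size_map => /(_ w4 w1).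
apply: contra => /allP fE; rewrite windows_map all_map; apply/allP => q qw /=.
rewrite -(edge_on_perm E (perm_map f (permEl (perm_sort leq q)))).
by apply: fE; apply: wL.
Qed.

(** A cross edge would complete a closed walk of length 13. The four walks are images of one another
    under the exchanges of 0 with 1 and of 2 with 3, which preserve the seven given edges. *)
Lemma no_cross_edge (T : finType) (E : {set {set T}}) (f : nat -> T) :
  C1_hom_free E ->
  all (fun q => edge_on E (map f q))
    [:: [:: 0; 1; 2; 3]; [:: 0; 1; 2; 4]; [:: 0; 1; 3; 4]; [:: 0; 1; 2; 5]; [:: 0; 1; 3; 5];
        [:: 0; 2; 3; 6]; [:: 1; 2; 3; 6]] ->
  ~~ has (fun q => edge_on E (map f q)) (unzip1 cross_pat).
Proof.
set L := (X in all _ X -> _) => free fL.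
have walk q w : 4 < size w -> size w %% 4 = 1 ->
    all (fun u => sort leq u \in q :: L) (windows w) -> ~~ edge_on E (map f q).
  move=> w4 w1 wL; have := odd_walk_free f free w4 w1 wL.
  by rewrite -(cat1s q L) all_cat all_seq1 fL andbT.
rewrite /= orbF !negb_or; apply/and4P; split.
- exact: (walk [:: 0; 2; 4; 5] [:: 0; 2; 3; 1; 0; 4; 2; 5; 0; 1; 2; 3; 6]).
- exact: (walk [:: 0; 3; 4; 5] [:: 0; 3; 2; 1; 0; 4; 3; 5; 0; 1; 3; 2; 6]).
- exact: (walk [:: 1; 2; 4; 5] [:: 1; 2; 3; 0; 1; 4; 2; 5; 1; 0; 2; 3; 6]).
- exact: (walk [:: 1; 3; 4; 5] [:: 1; 3; 2; 0; 1; 4; 3; 5; 1; 0; 3; 2; 6]).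
Qed.

Lemma sat_all (I : Type) (J : I -> bool) (p : seq (I * bool)) :
  sat J p = all (fun l => J l.1 == l.2) p.
Proof. by elim: p => //= -[q b] p ->; case: (J q); case: b. Qed.

(** * The two sums of squares *)

Section Counting.
Variables (T : finType) (E : {set {set T}}).
Hypothesis free : C1_hom_free E.

Notation quad := ((T * T) * (T * T))%type.

Definition quad_edge (q : quad) : bool := edge_on E [:: q.1.1; q.1.2; q.2.1; q.2.2].

Definition extends (q : quad) (b0 b1 b2 b3 : bool) (w : T) : bool :=
  [&& edge_on E [:: q.1.1; q.1.2; q.2.1; w] == b0, edge_on E [:: q.1.1; q.1.2; q.2.2; w] == b1,
      edge_on E [:: q.1.1; q.2.1; q.2.2; w] == b2 & edge_on E [:: q.1.2; q.2.1; q.2.2; w] == b3].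

Lemma frequency_ext (b a0 a1 a2 a3 c0 c1 c2 c3 : bool) :
  frequency E ((base_quad, b) :: ext 4 a0 a1 a2 a3 ++ ext 5 c0 c1 c2 c3)
  = \sum_(q : quad) (quad_edge q == b) *
      ((\sum_w extends q a0 a1 a2 a3 w) * (\sum_w extends q c0 c1 c2 c3 w)).
Proof.
rewrite /frequency.
transitivity (\sum_(q : quad) \sum_(p : T * T) (quad_edge q == b) *
   (extends q a0 a1 a2 a3 p.1 * extends q c0 c1 c2 c3 p.2)).
  rewrite pair_bigA; apply: eq_bigr => x _.
  by rewrite -cat1s !sat_cat !sat_all /= !andbT !mulnb.
apply: eq_bigr => q _; rewrite big_distrlr -big_distrr /=; congr (_ * _).
by rewrite pair_bigA.
Qed.

Lemma frequency_edge : frequency E edge_pat = #|T| ^ 2 * \sum_(q : quad) quad_edge q.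
Proof.
transitivity (\sum_(q : quad) \sum_(p : T * T) (quad_edge q : nat)).
  by rewrite pair_bigA; apply: eq_bigr => x _; rewrite sat_all /= andbT eqb_id.
rewrite big_distrr; apply: eq_bigr => q _ /=.
by rewrite big_const iter_addn_0 card_prod mulnC mulnn.
Qed.

Lemma frequency_cherry :
  frequency E cherry_pat
  = \sum_(p : T * T) (\sum_(r : T * T) quad_edge (p, r)) ^ 2.
Proof.
transitivity (\sum_(q : quad) \sum_(s : T * T) (quad_edge q * quad_edge (q.1, s))).
  by rewrite pair_bigA; apply: eq_bigr => x _; rewrite sat_all /= andbT !eqb_id mulnb.
transitivity (\sum_(p : T * T) \sum_(r : T * T) \sum_(s : T * T)
    (quad_edge (p, r) * quad_edge (p, s))).
  by rewrite [RHS]pair_bigA; apply: eq_bigr => -[].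
by apply: eq_bigr => p _; rewrite -mulnn big_distrlr.
Qed.

(** This is [(3A - B)^2 >= 0] summed over the non-edges. *)
Lemma one_co_bound :
  6 * frequency E one_co_pat <= 9 * frequency E one_one_pat + frequency E co_co_pat.
Proof.
rewrite !frequency_ext !big_distrr -big_split; apply: leq_sum => q _ /=.
set A := \sum_w _; set B := \sum_w _.
case: (_ == _); rewrite ?mul0n ?muln0 // !mul1n.
have := (nat_Cauchy (3 * A) B).1; rewrite expnMn -mulnA -!mulnn; move: (A * B) (A * A) (B * B). lia.
Qed.

(* Restricting (x - y)^2 to edges with x, y > 0 would suffice; this weaker condition still yields
   [cross_pat] and loses no product x y. *)
Definition crossed (q : quad) : bool :=
  [exists w, edge_on E [:: q.1.1; q.1.2; q.2.1; w] && edge_on E [:: q.1.1; q.1.2; q.2.2; w]] &&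
  [exists w, edge_on E [:: q.1.1; q.2.1; q.2.2; w] && edge_on E [:: q.1.2; q.2.1; q.2.2; w]].

(** On a crossed edge, any two vertices counted by the square satisfy [cross_pat], by
    [no_cross_edge]. *)
Lemma same_bound :
  \sum_(q : quad) (quad_edge q && crossed q) * (\sum_w extends q true true false false w) ^ 2
  <= frequency E (same_pat ++ cross_pat).
Proof.
apply: (@leq_trans (\sum_(q : quad) \sum_(p : T * T) (quad_edge q && crossed q) *
   (extends q true true false false p.1 * extends q true true false false p.2))).
  apply: leq_sum => q _; rewrite -mulnn big_distrlr -big_distrr /= leq_mul2l.
  by rewrite pair_bigA leqnn orbT.
rewrite pair_bigA; apply: leq_sum => x _; rewrite sat_all /=.
case: x => [[[a b] [c d]] [e f]]; rewrite !mulnb; case: andP => // -[/andP [abcd]].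
case/andP => [_ /existsP [w /andP [acdw bcdw]]] /andP [].
case/and4P => /eqP abce /eqP abde /eqP acde /eqP bcde.
case/and4P => /eqP abcf /eqP abdf /eqP acdf /eqP bcdf.
(* The default value [w] of [nth] plays the seventh point, of index 6. *)
have := @no_cross_edge T E (nth w [:: a; b; c; d; e; f]) free.
move: abcd acdw bcdw abce abde acde bcde abcf abdf acdf bcdf; rewrite /quad_edge /=.
move=> abcd -> -> abce abde acde bcde abcf abdf acdf bcdf.
rewrite abcd abce abde abcf abdf orbF !negb_or => /(_ isT) /and4P [x1 x2 x3 x4].
rewrite /edge_at /vertex /= abcd abce abde acde bcde abcf abdf acdf bcdf.
by rewrite (negbTE x1) (negbTE x2) (negbTE x3) (negbTE x4).
Qed.

Definition swap (q : quad) : quad := (q.2, q.1).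

Lemma swapK : involutive swap.
Proof. by case. Qed.

Lemma edge_on_rot3 (x y z w : T) : edge_on E [:: x; y; z; w] = edge_on E [:: y; z; x; w].
Proof.
congr (_ \in E); apply/setP => t; rewrite !inE.
by case: (t == x); case: (t == y); case: (t == z).
Qed.

Lemma quad_edge_swap (q : quad) : quad_edge (swap q) = quad_edge q.
Proof.
congr (_ \in E); apply/setP => t; rewrite !inE.
by case: (t == q.1.1); case: (t == q.1.2); rewrite ?orbT ?orbF.
Qed.

Lemma extends_swap (q : quad) (b0 b1 b2 b3 : bool) :
  extends (swap q) b0 b1 b2 b3 =1 extends q b2 b3 b0 b1.
Proof.
move=> w; rewrite /extends /= !(edge_on_rot3 q.2.1 q.2.2) !(edge_on_rot3 q.2.2 _ q.2.1).
rewrite !(edge_on_rot3 _ q.1.1 q.1.2).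
by move: (_ == b0) (_ == b1) (_ == b2) (_ == b3) => [] [] [] [].
Qed.

Lemma crossed_swap (q : quad) : crossed (swap q) = crossed q.
Proof.
rewrite /crossed andbC; congr (_ && _); apply: eq_existsb => w /=.
  by rewrite !(edge_on_rot3 _ q.1.1 q.1.2).
by rewrite !(edge_on_rot3 q.2.1 q.2.2) !(edge_on_rot3 q.2.2 _ q.2.1).
Qed.

Lemma crossed_extends (q : quad) (v w : T) :
  extends q true true false false v -> extends q false false true true w -> crossed q.
Proof.
case/and4P => /eqP h1 /eqP h2 _ _ /and4P [_ _ /eqP h3 /eqP h4].
by apply/andP; split; apply/existsP; [exists v; rewrite h1|exists w; rewrite h3].
Qed.

(** This is [2xy <= x^2 + y^2] with [x = A q] and [y = A (swap q)]: a nonzero product forces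
    [crossed], and [swap] permutes the crossed edges, so both squares have the same sum. *)
Lemma split_bound : frequency E split_pat <= frequency E (same_pat ++ cross_pat).
Proof.
apply: leq_trans same_bound.
rewrite frequency_ext.
pose A q := \sum_w extends q true true false false w.
pose R q : nat := quad_edge q && crossed q.
have A_gt0 q : 0 < A q -> exists w, extends q true true false false w.
  by rewrite lt0n sum_nat_eq0 => /forallPn [w]; rewrite eqb0 negbK; exists w.
apply: (@leq_trans (\sum_q R q * (A q * A (swap q)))).
  apply: leq_sum => q _; rewrite eqb_id /R -/(A q).
  have -> : \sum_w extends q false false true true w = A (swap q).
    by apply: eq_bigr => w _; rewrite extends_swap.
  case: (posnP (A q)) => [->|/A_gt0 [v hv]]; first by rewrite mul0n !muln0.
  case: (posnP (A (swap q))) => [->|/A_gt0 [w]]; first by rewrite !muln0.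
  by rewrite extends_swap => hw; rewrite (crossed_extends hv hw) andbT.
rewrite -(leq_pmul2l (isT : 0 < 2)) big_distrr /=.
apply: (@leq_trans (\sum_q (R q * A q ^ 2 + R q * A (swap q) ^ 2))).
  by apply: leq_sum => q _; rewrite -mulnDr mulnCA leq_mul2l (nat_Cauchy _ _).1 orbT.
rewrite big_split /= mul2n -addnn leq_add2l.
rewrite [X in _ <= X](reindex_inj (inv_inj swapK)) /=.
by apply: leq_sum => q _; rewrite /R quad_edge_swap crossed_swap.
Qed.

Lemma cherry_bound :
  2 * \sum_(p : T * T) (\sum_(r : T * T) quad_edge (p, r)) ^ 2
  <= #|T| ^ 2 * \sum_(q : quad) quad_edge q.
Proof.
have := sum_local_ineq free; have := one_co_bound; have := split_bound.
rewrite frequency_edge frequency_cherry.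
move: (frequency E _) (frequency E _) (frequency E _) (frequency E _) (frequency E _).
lia.
Qed.

(** * From codegrees to the number of edges *)

Hypothesis E4 : four_graph E.

Lemma quad_edge_uniq (q : quad) :
  quad_edge q -> uniq [:: q.1.1; q.1.2; q.2.1; q.2.2].
Proof.
move=> /E4; rewrite cardsE => c4; apply/card_uniqP; rewrite /= -c4.
by apply: eq_card => x; rewrite !inE.
Qed.

Lemma orderings_count (e : {set T}) :
  #|e| = 4 ->
  24 <= \sum_(q : quad) ([set:: [:: q.1.1; q.1.2; q.2.1; q.2.2]] == e).
Proof.
move=> e4; have /card_gt0P [x0 _] : 0 < #|e| by rewrite e4.
pose g s := (nth x0 s 0, nth x0 s 1, (nth x0 s 2, nth x0 s 3)).
pose h (q : quad) := [:: q.1.1; q.1.2; q.2.1; q.2.2].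
have hg : {in permutations (enum e), cancel g h}.
  move=> s; rewrite mem_permutations => /perm_size; rewrite -cardE e4.
  by case: s => [|a [|b [|c [|d []]]]].
have uL : uniq (map g (permutations (enum e))).
  by rewrite map_inj_in_uniq ?permutations_uniq //; apply: can_in_inj hg.
have <- : size (map g (permutations (enum e))) = 24.
  by rewrite size_map size_permutations ?enum_uniq // -cardE e4.
rewrite -(card_uniqP uL) -sum1_card big_mkcond /=; apply: leq_sum => q _.
case: ifP => // /mapP [s ps ->]; rewrite (_ : _ == e) //.
rewrite -[[:: _; _; _; _]]/(h (g s)) hg //; apply/eqP/setP => x.
by rewrite inE; move: ps; rewrite mem_permutations => /perm_mem ->; rewrite mem_enum.
Qed.

Lemma quad_edge_count : 24 * #|E| <= \sum_(q : quad) quad_edge q.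
Proof.
rewrite -sum1_card big_distrr /=.
apply: (@leq_trans (\sum_(e in E) \sum_(q : quad)
    ([set:: [:: q.1.1; q.1.2; q.2.1; q.2.2]] == e : nat))).
  by apply: leq_sum => e /E4 e4; rewrite muln1 orderings_count.
rewrite exchange_big; apply: leq_sum => q _ /=.
rewrite /quad_edge /edge_on; set S := [set:: _].
case: (boolP (S \in E)) => SE.
  rewrite (bigD1 S) //= eqxx big1 // => e /andP [_ ne].
  by rewrite eq_sym (negbTE ne).
by rewrite big1 // => e eE; case: eqP => // eS; rewrite eS eE in SE.
Qed.

(** Cauchy-Schwarz against the constant 1, by summing [2xy <= x^2 + y^2] over all pairs of
    indices. *)
Lemma sum_sqr_leq (I : finType) (P : pred I) (F : I -> nat) :
  (\sum_(i | P i) F i) ^ 2 <= #|P| * \sum_(i | P i) F i ^ 2.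
Proof.
rewrite -(leq_pmul2l (isT : 0 < 2)) -mulnn big_distrlr big_distrr /=.
apply: (@leq_trans (\sum_(i | P i) \sum_(j | P j) (F i ^ 2 + F j ^ 2))).
  apply: leq_sum => i _; rewrite big_distrr; apply: leq_sum => j _.
  by rewrite (nat_Cauchy _ _).1.
under eq_bigr => i _ do rewrite big_split sum_nat_const /=.
by rewrite big_split sum_nat_const -big_distrr /= addnn mul2n.
Qed.

(** Diagonal pairs have codegree 0, so Cauchy-Schwarz runs over the off-diagonal ones only; the
    resulting factor [#|T|.-1] makes the final bound strict. *)
Lemma codegree_cauchy :
  (\sum_(q : quad) quad_edge q) ^ 2
  <= #|T| * #|T|.-1 * \sum_(p : T * T) (\sum_(r : T * T) quad_edge (p, r)) ^ 2.
Proof.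
pose d p := \sum_(r : T * T) quad_edge (p, r).
pose off : pred (T * T) := fun p => p.2 != p.1.
have card_off : #|off| = #|T| * #|T|.-1.
  rewrite -sum1_card -(pair_big_dep xpredT (fun a b => b != a) (fun _ _ => 1)) /=.
  under eq_bigr => a _ do rewrite sum1_card cardC1.
  by rewrite sum_nat_const.
have -> : \sum_(q : quad) quad_edge q = \sum_(p | off p) d p.
  transitivity (\sum_p d p); first by rewrite pair_bigA; apply: eq_bigr => -[].
  rewrite (bigID off) /= [X in _ + X]big1 ?addn0 // => p; rewrite negbK => /eqP p12.
  apply: big1 => r _; apply/eqP; rewrite eqb0; apply/negP => /quad_edge_uniq.
  by rewrite /= p12 inE eqxx.
apply: (leq_trans (sum_sqr_leq _ _)); rewrite card_off leq_mul2l; apply/orP; right.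
by rewrite [X in _ <= X](bigID off) leq_addr.
Qed.

End Counting.

Theorem theorem5p7 (T : finType) (E : {set {set T}}) :
  four_graph E -> 1 <= #|T| -> C1_hom_free E ->
  48 * #|E| < #|T| ^ 4.
Proof.
move=> E4 T_gt0 free.
have := quad_edge_count E4; have := codegree_cauchy E4; have := cherry_bound free.
move: (\sum_q _) (\sum_p _) => s d.
case: #|T| T_gt0 => // n _ /=.
move=> h1 h2 h3.
(* Here [n.+1] is the number of vertices; [h1] and [h2] bound [2 * s ^ 2] by a multiple of [s],
   which cancels. *)
have h4 : 2 * s <= n * n.+1 ^ 3.
  case: (posnP s) => [->//|s_gt0]; rewrite -(leq_pmul2r s_gt0).
  apply: (@leq_trans (n.+1 * n * (2 * d))); first by move: h2; lia.
  apply: (leq_trans (leq_mul (leqnn _) h1)); rewrite !expnS; lia.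
apply: (@leq_ltn_trans (n * n.+1 ^ 3)); first by lia.
by rewrite [n.+1 ^ 4]expnS ltn_pmul2r // expn_gt0.
Qed.
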